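(* The expandable SOS game is a win for the first player.
   Context: Expandable SOS game: the board starts as a single empty cell ($1\times 1$). Turns are numbered $1,2,3,\dots$; the first player moves on odd turns and the second player on even turns. On each turn the player to move writes either an S or an O in an empty cell of the current board. After each odd-numbered turn, one new row of empty cells is added at the bottom of the board; after each even-numbered turn, one new column of empty cells is added at the right of the board. (So the board is $2\times 1$ for turn 2, $2\times 2$ for turn 3, $3\times 2$ for turn 4, $3\times 3$ for turn 5, and so on, where $a\times b$ means $a$ rows and $b$ columns.) The first player whose move produces three consecutive cells in a row, column, or diagonal spelling SOS wins (no matter who wrote the individual letters). Both players are assumed to play optimally: ''a win for the first player'' means that the first player has a winning strategy. *)

(* Defs.v *)
From mathcomp Require Import all_boot.

Set Implicit Arguments.
Unset Strict Implicit.
Unset Printing Implicit Defensive.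

Inductive letter := LetterS | LetterO.

(* (row, column), counted from 0; the initial cell is (0, 0), rows are added
   below and columns to the right, so cells never change coordinates. *)
Definition cell : Type := nat * nat.

Definition move : Type := cell * letter.

(* Chronological list of the moves played; with history [h], the turn about
   to be played is number [(size h).+1]. *)
Definition history : Type := seq move.

(* (number of rows, number of columns) after [t] turns. *)
Fixpoint board_size (t : nat) : nat * nat :=
  if t is t'.+1 then
    let: (r, c) := board_size t' in
    if odd t then (r.+1, c) else (r, c.+1)
  else (1, 1).

Fixpoint letter_at (h : history) (x : cell) : option letter :=
  if h is (y, l) :: h' then if y == x then Some l else letter_at h' x
  else None.

Definition on_board (h : history) (x : cell) : Prop :=
  x.1 < (board_size (size h)).1 /\ x.2 < (board_size (size h)).2.

Definition legal_move (h : history) (m : move) : Prop :=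
  on_board h m.1 /\ letter_at h m.1 = None.

Definition spells_SOS (h : history) (x y z : cell) : Prop :=
  [/\ letter_at h x = Some LetterS,
      letter_at h y = Some LetterO &
      letter_at h z = Some LetterS].

(* The four disjuncts are a row, a column and the two diagonal directions;
   SOS is a palindrome, so the direction of reading is irrelevant. *)
Definition has_SOS (h : history) : Prop :=
  exists i j : nat,
    [\/ spells_SOS h (i, j) (i, j.+1) (i, j.+2),
        spells_SOS h (i, j) (i.+1, j) (i.+2, j),
        spells_SOS h (i, j) (i.+1, j.+1) (i.+2, j.+2) |
        spells_SOS h (i, j.+2) (i.+1, j.+1) (i.+2, j)].

(* Histories of legal moves after which the game is not over. *)
Inductive ongoing : history -> Prop :=
| ongoing_start : ongoing [::]
| ongoing_move h m :
    ongoing h -> legal_move h m -> ~ has_SOS (rcons h m) ->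
    ongoing (rcons h m).

Inductive player := First | Second.

Definition to_move (h : history) : player :=
  if odd (size h).+1 then First else Second.

Definition strategy : Type := history -> move.

(* The value of a strategy at histories where its player is not to move, or
   where the game is over, is irrelevant. *)
Definition legal_strategy (p : player) (s : strategy) : Prop :=
  forall h, ongoing h -> to_move h = p -> legal_move h (s h).

(* The history after [t] turns. It is harmlessly continued past the end of
   the game. *)
Fixpoint play (s1 s2 : strategy) (t : nat) : history :=
  if t is t'.+1 then
    let h := play s1 s2 t' in
    rcons h (if to_move h is First then s1 h else s2 h)
  else [::].

(* Before turn [t] there is no SOS, so the move of turn [t] produces one. *)
Definition game_won_at (s1 s2 : strategy) (t : nat) : Prop :=
  has_SOS (play s1 s2 t) /\ forall t', t' < t -> ~ has_SOS (play s1 s2 t').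

Definition first_player_winning_strategy (s1 : strategy) : Prop :=
  legal_strategy First s1 /\
  forall s2, legal_strategy Second s2 ->
    exists t, odd t /\ game_won_at s1 s2 t.

(* Main.v *)
Require Import Defs.
From HB Require Import structures.
From mathcomp Require Import all_boot.

(** The growth of the board favours the first player: a column appears after
    each move of the second player, so the first player is always the first to
    write in it.  Suppose that he writes an O in the last column, immediately
    to the right of an S.  The missing S then belongs to a cell that does not
    exist yet, hence that the second player cannot fill or use, and that the
    first player finds empty on his next turn.  He wins there, unless the
    second player completes another SOS in between.

    The first player builds this trap in the top row, by writing O, S, O, S
    there, each time in the newest column.  He departs from this in two cases.
    - If the second player answers the first O by an S below it, the first
      player uses that S: he continues its row with O and then S, and wins on
      turn 5.
    - If after O, S in the top row and an O below the first O the second player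
      makes an SOS possible in the second column, the first player completes
      it, again on turn 5.
    In the other lines the trap closes on turn 7.  That the second player never
    gets an SOS on turns 2, 4 and 6 is a finite verification, [osos_forces],
    turned into a statement about all opponents by [forces_wins].  A strategy
    also has to be legal in the positions that it never reaches; this is so
    because the newest column is empty ([newest_column_empty]). *)

Definition letter_is_S (l : letter) : bool := if l is LetterS then true else false.
Definition letter_of_bool (b : bool) : letter := if b then LetterS else LetterO.

Lemma letter_is_SK : cancel letter_is_S letter_of_bool.
Proof. by case. Qed.

HB.instance Definition _ := Equality.copy letter (can_type letter_is_SK).

(** * Shape of the board *)

Lemma board_sizeE t : board_size t = ((uphalf t).+1, (t./2).+1).
Proof.
elim: t => //= t ->; rewrite uphalf_half.
by case: (odd t); rewrite ?addn0 ?add0n ?add1n.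
Qed.

Lemma letter_at_rcons h m x :
  letter_at (rcons h m) x =
  if letter_at h x is Some l then Some l
  else if m.1 == x then Some m.2 else None.
Proof. by elim: h => [|[y l] h IH] /=; [case: m | case: eqP]. Qed.

(** A bound by the number of columns at the time of the last move, instead of
    the present one: the two differ when the first player is to move. *)
Lemma ongoing_column_lt {h x l} :
  ongoing h -> letter_at h x = Some l -> x.2 < uphalf (size h).
Proof.
move=> og; elim: og x l => [|{}h m _ IH [[_ on_c] _] _] x l //.
rewrite letter_at_rcons size_rcons /=.
case lx: (letter_at h x) => [l'|].
  move=> _; apply: (leq_trans (IH _ _ lx)).
  by rewrite uphalf_half -add1n leq_add2r leq_b1.
by case: eqP => // <- _; rewrite board_sizeE in on_c.
Qed.

Lemma newest_column_empty h i :
  ongoing h -> ~~ odd (size h) -> letter_at h (i, (size h)./2) = None.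
Proof.
move=> og ev; case lx: letter_at => [l|] //.
by have:= ongoing_column_lt og lx; rewrite uphalf_half (negbTE ev) ltnn.
Qed.

(** * Deciding the end of the game *)

Definition spellsb (h : history) (x y z : cell) : bool :=
  [&& letter_at h x == Some LetterS, letter_at h y == Some LetterO
    & letter_at h z == Some LetterS].

Lemma spellsP h x y z : reflect (spells_SOS h x y z) (spellsb h x y z).
Proof. by apply: (iffP and3P) => -[xS yO zS]; split; apply/eqP. Qed.

(** Each SOS is searched from its uppermost cell, or from the leftmost one if
    it is horizontal, since that cell holds a letter. *)
Definition sosb (h : history) : bool :=
  has (fun x : cell => let: (i, j) := x in
    [|| spellsb h (i, j) (i, j.+1) (i, j.+2),
        spellsb h (i, j) (i.+1, j) (i.+2, j),
        spellsb h (i, j) (i.+1, j.+1) (i.+2, j.+2) |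
        (1 < j) && spellsb h (i, j) (i.+1, j.-1) (i.+2, j.-2)])
  (unzip1 h).

Lemma mem_letter_at h x l : letter_at h x = Some l -> x \in unzip1 h.
Proof.
elim: h => //= -[y l'] h IH; rewrite inE eq_sym.
by case: eqP => //= _ /IH.
Qed.

Lemma sosP h : reflect (has_SOS h) (sosb h).
Proof.
apply: (iffP hasP) => [[[i j] _ /or4P[]]|[i [j sos]]].
- by move=> /spellsP s; exists i, j; apply: Or41.
- by move=> /spellsP s; exists i, j; apply: Or42.
- by move=> /spellsP s; exists i, j; apply: Or43.
- case: j => [|[|j]] //= /spellsP s.
  by exists i, j; apply: Or44.
have mem x y z : spells_SOS h x y z -> x \in unzip1 h.
  by case=> /mem_letter_at.
case: sos => s; have xh := mem _ _ _ s; move/spellsP: s => s;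
  [exists (i, j) | exists (i, j) | exists (i, j) | exists (i, j.+2)] => //=; by rewrite s ?orbT.
Qed.

Definition legal_moves (h : history) : seq move :=
  let: (r, c) := board_size (size h) in
  [seq m <- [seq (x, l) | x <- [seq (i, j) | i <- iota 0 r, j <- iota 0 c],
                          l <- [:: LetterS; LetterO]]
     | letter_at h m.1 == None].

Lemma mem_legal_moves h m : legal_move h m -> m \in legal_moves h.
Proof.
case: m => -[i j] l [[]] /=; rewrite /legal_moves.
case: board_size => r c ir jc lx; rewrite mem_filter lx eqxx andTb.
apply/allpairsPdep; exists (i, j), l; split=> //; last by case: (l).
by apply/allpairsPdep; exists i, j; rewrite !mem_iota.
Qed.

(** * Winning against every opponent by a finite verification *)

(** Meant for [h] with the first player to move; [n] counts his moves only. *)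
Fixpoint forces (s : strategy) (n : nat) (h : history) : bool :=
  if n is n'.+1 then
    let h1 := rcons h (s h) in
    sosb h1 ||
    all (fun m => let h2 := rcons h1 m in ~~ sosb h2 && forces s n' h2)
        (legal_moves h1)
  else false.

Lemma size_play s1 s2 t : size (play s1 s2 t) = t.
Proof. by elim: t => //= t IH; rewrite size_rcons IH. Qed.

(** A legal opponent always picks one of the enumerated replies, so the play
    descends the tree explored by [forces], which ends in wins only. *)
Lemma forces_wins s1 s2 n t :
  legal_strategy First s1 -> legal_strategy Second s2 ->
  ~~ odd t -> ongoing (play s1 s2 t) ->
  (forall t', t' <= t -> ~ has_SOS (play s1 s2 t')) ->
  forces s1 n (play s1 s2 t) ->
  exists t, odd t /\ game_won_at s1 s2 t.
Proof.
move=> leg1 leg2; elim: n t => // n IH t ev og noSOS.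
have turn1 : to_move (play s1 s2 t) = First.
  by rewrite /to_move size_play /= ev.
have pS : play s1 s2 t.+1 = rcons (play s1 s2 t) (s1 (play s1 s2 t)).
  by rewrite /= turn1.
rewrite [forces _ _ _]/= -pS; case: sosP => [sos _|nsos /= /allP win].
  by exists t.+1; rewrite /= ev.
have og1 : ongoing (play s1 s2 t.+1).
  by move: nsos; rewrite pS => nsos; apply: ongoing_move => //; apply: leg1.
have turn2 : to_move (play s1 s2 t.+1) = Second.
  by rewrite /to_move size_play /= (negbTE ev).
have leg := leg2 _ og1 turn2.
have /andP[/sosP nsos2 win2] := win _ (mem_legal_moves _ _ leg).
have pSS : play s1 s2 t.+2 = rcons (play s1 s2 t.+1) (s2 (play s1 s2 t.+1)).
  by rewrite [LHS]/= -/(play s1 s2 t.+1) turn2.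
rewrite -pSS in nsos2 win2.
apply: IH win2; first by rewrite /= negbK.
  by move: nsos2; rewrite pSS => nsos2; apply: ongoing_move.
move=> t'; rewrite leq_eqVlt => /predU1P[-> //|].
by rewrite ltnS leq_eqVlt => /predU1P[-> //|/noSOS].
Qed.

(** * The strategy of the first player *)

(** The opening after which the second column needs attention. *)
Definition column_opening : history :=
  [:: ((0, 0), LetterO); ((1, 0), LetterO); ((0, 1), LetterS)].

(** Apart from the two completions in the second column, the first player
    writes in the newest column: in the top row, or in the next one if the
    second player started it with an S.  The S's belong to columns 1 and 3 of
    the top row and to columns 0 and 2 of the next one, whence the parity. *)
Definition osos_strategy (h : history) : move :=
  let row : nat := nth ((0, 0), LetterO) h 1 == ((1, 0), LetterS) in
  let col := (size h)./2 in
  if h == rcons column_opening ((1, 1), LetterO) then ((2, 1), LetterS)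
  else if h == rcons column_opening ((2, 1), LetterS) then ((1, 1), LetterO)
  else ((row, col), if odd (row + col) then LetterS else LetterO).

Lemma osos_legal : legal_strategy First osos_strategy.
Proof.
move=> h og; rewrite /to_move /=; case: ifP => // ev _.
rewrite /osos_strategy; case: eqP => [-> //|_]; case: eqP => [-> //|_].
split; last exact: newest_column_empty.
rewrite /on_board board_sizeE /=; split=> //.
(* A second move has been made if the row is not the top one. *)
by case: eqP => //; case: (h) => [|? [|? ?]].
Qed.

(** The longest lines end on turn 7, the fourth move of the first player. *)
Lemma osos_forces : forces osos_strategy 4 [::].
Proof. by vm_compute. Qed.

Theorem theorem13 : exists s1 : strategy, first_player_winning_strategy s1.
Proof.
exists osos_strategy; split=> [|s2 leg2]; first exact: osos_legal.
apply: (@forces_wins _ _ 4 0 osos_legal leg2 isT ongoing_start _ osos_forces).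
by move=> t'; rewrite leqn0 => /eqP -> /sosP.
Qed.
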